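(* Algorithm $\texttt{RDTP()}$ (described in the context) is correct: on any RDTN $\mathcal{N}=(\mathcal{T},\mathcal{C}_{\texttt{t}_1}\cup\mathcal{C}_{\texttt{t}_2}\cup\mathcal{C}_{\texttt{t}_3})$ it returns a feasible schedule $\mathcal{T}\to\mathbb{R}$ if $\mathcal{N}$ is consistent; otherwise $\mathcal{N}$ is recognized as inconsistent.
   Context: An RDTN is $(\mathcal{T},\mathcal{C}_{\texttt{t}_1}\cup\mathcal{C}_{\texttt{t}_2}\cup\mathcal{C}_{\texttt{t}_3})$ with $\mathcal{T}$ a finite totally ordered set of time-points and constraints: ($\texttt{t}_1$) $(Y-X\le w_{X,Y})$, $X,Y\in\mathcal{T}$, $w\in\mathbb{R}$; ($\texttt{t}_2$) $\bigvee_{i=1}^k(l_i\le X\le u_i)$, $X\in\mathcal{T}$, $l_i,u_i\in\mathbb{R}$; ($\texttt{t}_3$) $(l_1\le X\le u_1)\vee(l_2\le Y\le u_2)$ with $X$ preceding $Y$ in the order; $d'_c=(l_1\le X\le u_1)$, $d''_c=(l_2\le Y\le u_2)$ are the first and second disjunct of $c$. A schedule $s:\mathcal{T}\to\mathbb{R}$ is feasible if it satisfies all constraints; $\mathcal{N}$ is consistent if one exists. The least feasible schedule of a consistent network is the non-negative feasible schedule pointwise $\le$ every non-negative feasible schedule. For a disjunct $d=(l\le X\le u)$ of $c\in\mathcal{C}_{\texttt{t}_3}$, $\mathcal{N}[d]_{\texttt{t}_2}$ has time-points $\mathcal{T}\cup\{z\}$ and constraints $\mathcal{C}_{\texttt{t}_1}\cup\{(z-X\le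 -l),(X-z\le u)\}\cup\{(z-T\le0)\mid T\in\mathcal{T}\}\cup\mathcal{C}_{\texttt{t}_2}$; if consistent, $\hat\varphi[d]$ is its least feasible schedule. The 2-CNF $\textsc{Cl}_{\mathcal{N}}$ over $\{x_c\}_{c\in\mathcal{C}_{\texttt{t}_3}}$ contains, for each $c$: $\neg x_c$ if $\mathcal{N}[d'_c]_{\texttt{t}_2}$ is inconsistent, else for each $\tilde c=(\tilde l_1\le X_{\tilde i}\le\tilde u_1)\vee(\tilde l_2\le X_{\tilde j}\le\tilde u_2)\ne c$ in $\mathcal{C}_{\texttt{t}_3}$ the clause $\neg x_c\vee\neg x_{\tilde c}$ if $\hat\varphi[d'_c](X_{\tilde i})>\tilde u_1$ and $\neg x_c\vee x_{\tilde c}$ if $\hat\varphi[d'_c](X_{\tilde j})>\tilde u_2$; $x_c$ if $\mathcal{N}[d''_c]_{\texttt{t}_2}$ is inconsistent, else for each such $\tilde c$ the clause $x_c\vee\neg x_{\tilde c}$ if $\hat\varphi[d''_c](X_{\tilde i})>\tilde u_1$ and $x_c\vee x_{\tilde c}$ if $\hat\varphi[d''_c](X_{\tilde j})>\tilde u_2$. Algorithm $\texttt{RDTP()}$: check consistency of $(\mathcal{T},\mathcal{C}_{\texttt{t}_1}\cup\mathcal{C}_{\texttt{t}_2})$; if inconsistent report inconsistency. Otherwise build $\textsc{Cl}_{\mathcal{N}}$ and solve it as a 2-SAT instance; if unsatisfiable report inconsistency. Otherwise, with a satisfying assignment $\phi$, let $d^\phi_c=d'_c$ if $\phi(x_c)=\texttt{true}$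 and $d''_c$ otherwise, and return $\check\varphi_{\mathcal{N}}(T)=\max_{c\in\mathcal{C}_{\texttt{t}_3}}\hat\varphi[d^\phi_c](T)$, $T\in\mathcal{T}$.
   Formalization: The time-point z is fixed at 0 in N[d]; a consistent N is assumed to have a non-negative feasible schedule (the algorithm fails otherwise); when there are no type-3 constraints, the least feasible schedule is returned in place of the undefined empty maximum. *)

(* Defs.v *)
From HB Require Import structures.
From mathcomp Require Import all_boot all_order all_algebra.
From mathcomp Require Import boolp classical_sets reals.

Set Implicit Arguments.
Unset Strict Implicit.
Unset Printing Implicit Defensive.

Import Order.TTheory GRing.Theory Num.Theory.
Local Open Scope ring_scope.

(* MathComp / MathComp-Analysis development.  Finite sets of constraints are
   given by sequences; only membership in them is ever used, apart from the
   maximum taken over the type-3 constraints, which is insensitive to order and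
   repetition. *)

Section Networks.
Variable R : realType.

(* [(X, (l, u))] is the disjunct [l <= X <= u]. *)
Definition disjunct (T : Type) : Type := (T * (R * R))%type.
Definition tpt (T : Type) (d : disjunct T) : T := d.1.
Definition lo (T : Type) (d : disjunct T) : R := d.2.1.
Definition hi (T : Type) (d : disjunct T) : R := d.2.2.

Definition sat_disjunct (T : Type) (s : T -> R) (d : disjunct T) : bool :=
  lo d <= s (tpt d) <= hi d.

(* [(X, Y, w)] is the constraint [Y - X <= w]. *)
Definition t1_constraint (T : Type) : Type := (T * T * R)%type.
Definition sat_t1 (T : Type) (s : T -> R) (c : t1_constraint T) : bool :=
  s c.1.2 - s c.1.1 <= c.2.

(* [(X, [:: (l1, u1); ...; (lk, uk)])] is the constraint
   [l1 <= X <= u1 \/ ... \/ lk <= X <= uk]. *)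
Definition t2_constraint (T : Type) : Type := (T * seq (R * R))%type.
Definition sat_t2 (T : Type) (s : T -> R) (c : t2_constraint T) : bool :=
  has (fun I : R * R => I.1 <= s c.1 <= I.2) c.2.

(* [c.1] and [c.2] are the first and the second disjunct of [c]. *)
Definition t3_constraint (T : Type) : Type := (disjunct T * disjunct T)%type.
Definition sat_t3 (T : Type) (s : T -> R) (c : t3_constraint T) : bool :=
  sat_disjunct s c.1 || sat_disjunct s c.2.

(* The networks without type-3 constraints. *)
Record t2_network (T : Type) := T2Network {
  ct1 : seq (t1_constraint T);
  ct2 : seq (t2_constraint T)
}.

Record rdtn (disp : Order.disp_t) (T : finOrderType disp) := RDTN {
  t2_part :> t2_network T;
  ct3 : seq (t3_constraint T);
  ct3_ordered : all (fun c => (tpt c.1 < tpt c.2)%O) ct3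
}.

Definition t2_feasible (T : Type) (M : t2_network T) (s : T -> R) : Prop :=
  all (sat_t1 s) (ct1 M) && all (sat_t2 s) (ct2 M).

Definition t2_consistent (T : Type) (M : t2_network T) : Prop :=
  exists s : T -> R, t2_feasible M s.

Definition feasible (disp : Order.disp_t) (T : finOrderType disp)
    (N : rdtn T) (s : T -> R) : Prop :=
  t2_feasible N s /\ all (sat_t3 s) (ct3 N).

Definition consistent (disp : Order.disp_t) (T : finOrderType disp)
    (N : rdtn T) : Prop :=
  exists s : T -> R, feasible N s.

Definition nonneg_schedule (T : Type) (s : T -> R) : Prop :=
  forall X, 0 <= s X.

Definition is_least_feasible (T : Type) (M : t2_network T) (s : T -> R)
    : Prop :=
  [/\ nonneg_schedule s, t2_feasible M s
    & forall s', nonneg_schedule s' -> t2_feasible M s' ->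
        forall X, s X <= s' X].

(* The default value, used when there is no least feasible schedule, is
   irrelevant. *)
Definition least_feasible (T : Type) (M : t2_network T) : T -> R :=
  xget (fun=> 0) [set s | is_least_feasible M s]%classic.

Section Algorithm.
Variables (disp : Order.disp_t) (T : finOrderType disp).

(* The time-points are those of [N] together with [z], encoded as [None].
   [z] is the zero time-point from which the bounds of all unary constraints
   are measured; this is enforced by the type-2 constraint [0 <= z <= 0].  If
   [z] could move, a type-2 constraint [5 <= X <= 6] would be compatible with
   the disjunct [0 <= X <= 1]. *)
Definition disjunct_network (M : t2_network T) (d : disjunct T)
    : t2_network (option T) :=
  T2Network
    ([seq (Some c.1.1, Some c.1.2, c.2) | c <- ct1 M]
     ++ [:: (Some (tpt d), None, - lo d); (None, Some (tpt d), hi d)]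
     ++ [seq (Some X, None, 0) | X <- enum T])
    ((None, [:: (0, 0)]) :: [seq (Some c.1, c.2) | c <- ct2 M]).

Definition phi_hat (M : t2_network T) (d : disjunct T) (X : T) : R :=
  least_feasible (disjunct_network M d) (Some X).

End Algorithm.
End Networks.

(* The literal [(x, true)] is [x] and [(x, false)] is its negation. *)
Definition literal (V : Type) : Type := (V * bool)%type.
Definition cnf (V : Type) : Type := seq (seq (literal V)).

Definition sat_cnf (V : Type) (phi : V -> bool) (F : cnf V) : bool :=
  all (has (fun l : literal V => phi l.1 == l.2)) F.

Definition is_2cnf (V : Type) (F : cnf V) : bool :=
  all (fun cl : seq (literal V) => (size cl <= 2)%N) F.

Definition solves_2sat (V : Type) (solve : cnf V -> option (V -> bool))
    : Prop :=
  forall F : cnf V, is_2cnf F ->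
    match solve F return Prop with
    | Some phi => sat_cnf phi F
    | None => ~ exists phi : V -> bool, sat_cnf phi F
    end.

Section RDTP.
Variables (R : realType) (disp : Order.disp_t) (T : finOrderType disp).

(* The disjunct of [c] selected by the value [b] of [x_c]. *)
Definition sel_disjunct (c : t3_constraint R T) (b : bool) : disjunct R T :=
  if b then c.1 else c.2.

(* The clauses contributed by the first ([b = true]) or the second
   ([b = false]) disjunct of [c]; the literal [(c, ~~ b)] says that this
   disjunct is not selected. *)
Definition clauses_of (N : rdtn R T) (c : t3_constraint R T) (b : bool)
    : cnf (t3_constraint R T) :=
  if `[< t2_consistent (disjunct_network N (sel_disjunct c b)) >] then
    flatten
      [seq (if phi_hat N (sel_disjunct c b) (tpt c'.1) > hi c'.1
            then [:: [:: (c, ~~ b); (c', false)]] else [::])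
        ++ (if phi_hat N (sel_disjunct c b) (tpt c'.2) > hi c'.2
            then [:: [:: (c, ~~ b); (c', true)]] else [::])
      | c' <- ct3 N & c' != c]
  else [:: [:: (c, ~~ b)]].

Definition Cl (N : rdtn R T) : cnf (t3_constraint R T) :=
  flatten [seq clauses_of N c true ++ clauses_of N c false | c <- ct3 N].

(* The pointwise maximum of the schedules [phi_hat] of the selected disjuncts;
   without type-3 constraints there is nothing to take the maximum of, and the
   least feasible schedule of the network itself is returned. *)
Definition phi_check (N : rdtn R T) (phi : t3_constraint R T -> bool)
    : T -> R :=
  match ct3 N with
  | [::] => least_feasible N
  | c0 :: cs => fun X =>
      \big[Num.max/phi_hat N (sel_disjunct c0 (phi c0)) X]_(c <- cs)
        phi_hat N (sel_disjunct c (phi c)) X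
  end.

(* [None] is the report that the network is inconsistent.  The 2-SAT solver,
   which chooses the satisfying assignment, is a parameter. *)
Definition RDTP
    (solve : cnf (t3_constraint R T) -> option (t3_constraint R T -> bool))
    (N : rdtn R T) : option (T -> R) :=
  if `[< t2_consistent N >] then
    if solve (Cl N) is Some phi then Some (phi_check N phi) else None
  else None.

End RDTP.

(* Main.v *)
Require Import Defs.
From mathcomp Require Import all_boot all_order all_algebra.
From mathcomp Require Import boolp classical_sets reals.

(** Feasibility of a network without type-3 constraints is preserved by
    pointwise infima (which yields least feasible schedules) and by pointwise
    maxima.  If [s] is non-negative and feasible for the whole network, then
    [x_c := (s satisfies the first disjunct of c)] satisfies [Cl N], because
    [phi_hat d <= s] for every disjunct [d] satisfied by [s].  Conversely, the
    clauses say that no [phi_hat] of a selected disjunct exceeds the upper bound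
    of another selected disjunct, so the maximum of these schedules respects all
    the upper bounds; it respects the lower bounds since it dominates each of
    them. *)

Set Implicit Arguments.
Unset Strict Implicit.
Unset Printing Implicit Defensive.

Import Order.TTheory GRing.Theory Num.Theory.
Local Open Scope ring_scope.

(** A finite union of closed intervals is closed under limits from the right. This lets disjunctive
    unary constraints pass to infima. *)
Lemma has_itv_limit (R : realType) (Is : seq (R * R)) (m : R) :
  (forall e, 0 < e ->
     exists x, [/\ m <= x, x < m + e & has (fun I => I.1 <= x <= I.2) Is]) ->
  has (fun I => I.1 <= m <= I.2) Is.
Proof.
elim: Is => [|[l u] Is IH] H /=; first by have [x []] := H 1 ltr01.
have [//|Hlu /=] := boolP (l <= m <= u).
apply: IH => e e0; have [lem|ltm] := leP l m.
  have [x [mx xe /=]] := H e e0.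
  case/orP=> [/andP[_ xu]|Hx]; last by exists x.
  by rewrite lem (le_trans mx xu) in Hlu.
(* When [m < l], points within [l - m] of [m] miss [[l, u]] and so lie in the remaining
   intervals. *)
have ml0 : 0 < Num.min e (l - m) by rewrite lt_min e0 subr_gt0.
have [x [mx xe /=]] := H _ ml0.
rewrite -ltrBlDl lt_min !ltrBlDl addrC in xe.
case/andP: xe => xe xl.
case/orP=> [/andP[lx _]|Hx].
  by move: xl; rewrite addrC subrK ltNge lx.
by exists x; rewrite addrC.
Qed.

Section LeastFeasible.
Variables (R : realType) (T : Type) (M : t2_network R T).

Lemma least_feasibleP (s0 : T -> R) :
  nonneg_schedule s0 -> t2_feasible M s0 ->
  is_least_feasible M (least_feasible M).
Proof.
move=> nn0 f0; apply: xgetPex.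
pose A X := [set s X | s in [set s | nonneg_schedule s /\ t2_feasible M s]]%classic.
have A0 X : (A X !=set0)%classic by exists (s0 X), s0.
have lbA X : has_lbound (A X) by exists 0 => _ [s [nns _] <-].
have infA X : has_inf (A X) by [].
have leA s X : nonneg_schedule s -> t2_feasible M s -> inf (A X) <= s X.
  by move=> nns fs; apply: ge_inf => //; exists s.
exists (fun X => inf (A X)); split=> [X||s nns fs X].
- by apply: lb_le_inf => // _ [s [nns _] <-].
- apply/andP; split.
    (* The list of constraints shrinks during the induction, while the schedules still range over
       those feasible for the whole of [M], so that [A] is unchanged. *)
    elim: (ct1 M) (fun s (fs : t2_feasible M s) => proj1 (andP fs))
      => //= -[[X Y] w] cs IH H.
    rewrite IH ?andbT => [|s /H /andP[]//].
    rewrite /sat_t1 /= lerBlDl -lerBlDr.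
    apply: lb_le_inf => // _ [s [nns fs] <-].
    have /andP[+ _] := H s fs; rewrite /sat_t1 /= => Hw.
    rewrite lerBlDr -lerBlDl; apply: le_trans Hw.
    by rewrite lerB// leA.
  elim: (ct2 M) (fun s (fs : t2_feasible M s) => proj2 (andP fs))
    => //= -[X Is] cs IH H.
  rewrite IH ?andbT => [|s /H /andP[]//].
  rewrite /sat_t2 /=; apply: has_itv_limit => e e0.
  have [_ [s [nns fs] <-] lts] := inf_adherent e0 (infA X).
  exists (s X); split=> //; first exact: leA.
  by have /andP[] := H s fs.
- exact: leA.
Qed.

End LeastFeasible.

(** For [Y - X <= w], take the [f i] attaining the maximum at [Y]: its value at [X] is at most
    [s X]. A unary constraint on [X] is inherited from the [f i] attaining the maximum at [X]. *)
Lemma t2_feasible_max (R : realType) (T : Type) (M : t2_network R T)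
    (I : eqType) (r : seq I) (f : I -> T -> R) (s : T -> R) :
  (forall i, i \in r -> t2_feasible M (f i)) ->
  (forall X, (forall i, i \in r -> f i X <= s X) /\
             exists2 i, i \in r & s X = f i X) ->
  t2_feasible M s.
Proof.
move=> Hf Hs; apply/andP; split.
  elim: (ct1 M) (fun i (ir : i \in r) => proj1 (andP (Hf i ir)))
    => //= -[[X Y] w] cs IH H.
  rewrite IH ?andbT => [|i /H /andP[]//].
  have [i ir sE] := (Hs Y).2.
  have /andP[+ _] := H i ir; rewrite /sat_t1 /= sE; apply: le_trans.
  by rewrite lerB// (Hs X).1.
elim: (ct2 M) (fun i (ir : i \in r) => proj2 (andP (Hf i ir)))
  => //= -[X Is] cs IH H.
rewrite IH ?andbT => [|i /H /andP[]//].
have [i ir sE] := (Hs X).2.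
by have /andP[+ _] := H i ir; rewrite /sat_t2 /= sE.
Qed.

Lemma bigmax_attained (R : realType) (I : eqType) (i0 : I) (r : seq I)
    (F : I -> R) (m := \big[Num.max/F i0]_(i <- r) F i) :
  (forall i, i \in i0 :: r -> F i <= m) /\ exists2 i, i \in i0 :: r & m = F i.
Proof.
rewrite {}/m; elim: r => [|j r [IH1 [i ir IH2]]].
  rewrite big_nil; split; last by exists i0; rewrite ?mem_head.
  by move=> i; rewrite inE => /eqP ->.
rewrite big_cons; split=> [k|].
  rewrite !inE le_max orbCA => /orP[/eqP ->|kr]; first by rewrite lexx.
  by rewrite IH1 ?orbT // inE.
case: leP => _; last by exists j; rewrite // !inE eqxx orbT.
exists i => //; move: ir; rewrite !inE => /orP[->//|->].
by rewrite !orbT.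
Qed.

Section DisjunctNetwork.
Variables (R : realType) (disp : Order.disp_t) (T : finOrderType disp).
Variables (M : t2_network R T) (d : disjunct R T).

(** Once [[0, 0]] pins [z] at 0, the differences with [z] become the two bounds of [d] and the
    non-negativity of every time-point. *)
Lemma disjunct_network_feasible (s : option T -> R) :
  t2_feasible (disjunct_network M d) s <->
  [/\ s None = 0, nonneg_schedule s, t2_feasible M (s \o some)
    & sat_disjunct (s \o some) d].
Proof.
rewrite /t2_feasible /disjunct_network.
have : forall X : T, X \in enum T by exact: mem_enum.
move: (enum T) => e memE.
rewrite /= !all_cat /= !all_map /= /sat_t1 /sat_t2 /sat_disjunct /=.
rewrite orbF -eq_le.
split=> [/and3P[/and4P[H1 H2 H3 /allP H4] /eqP H5 H6]|].
  rewrite -H5 sub0r lerN2 in H2; rewrite -H5 subr0 in H3.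
  split=> //; [|by apply/andP|by rewrite H2 H3].
  case=> [X|]; last by rewrite -H5.
  by have := H4 X (memE X); rewrite /= -H5 sub0r oppr_le0.
case=> s0 nns /andP[H1 H6] /andP[H2 H3].
rewrite s0 eqxx sub0r lerN2 subr0 H1 H2 H3 H6 /= andbT.
by apply/allP => X _ /=; rewrite s0 sub0r oppr_le0.
Qed.

Lemma phi_hatP :
  t2_consistent (disjunct_network M d) ->
  [/\ nonneg_schedule (phi_hat M d), t2_feasible M (phi_hat M d)
    & sat_disjunct (phi_hat M d) d].
Proof.
case=> s fs; have [_ nns _ _] := (disjunct_network_feasible s).1 fs.
have [_ /disjunct_network_feasible[_ nn f sd] _] := least_feasibleP nns fs.
by split=> // X; apply: nn.
Qed.

Lemma phi_hat_le (s : T -> R) :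
  nonneg_schedule s -> t2_feasible M s -> sat_disjunct s d ->
  t2_consistent (disjunct_network M d) /\ forall X, phi_hat M d X <= s X.
Proof.
move=> nns fs sd; pose s' := oapp s 0.
have nns' : nonneg_schedule s' by case=> [X|] //=; apply: nns.
have fs' : t2_feasible (disjunct_network M d) s'.
  by apply/disjunct_network_feasible; split.
split=> [|X]; first by exists s'.
by have [_ _ least] := least_feasibleP nns' fs'; apply: (least s').
Qed.

End DisjunctNetwork.

Section Clauses.
Variables (R : realType) (disp : Order.disp_t) (T : finOrderType disp).
Variable N : rdtn R T.
Implicit Types (phi : t3_constraint R T -> bool) (c : t3_constraint R T).

Lemma Cl_is_2cnf : is_2cnf (Cl N).
Proof.
apply/allP => cl /flattenP[_ /mapP[c _ ->]].
rewrite mem_cat /clauses_of => /orP[]; case: ifP => _; rewrite ?inE;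
  try (by move/eqP ->);
  move=> /flattenP[_ /mapP[c' _ ->]]; rewrite mem_cat => /orP[];
  by case: ifP => _ //; rewrite inE => /eqP ->.
Qed.

(** Every clause of an unselected disjunct of [c] contains a literal on [c] that [phi] makes true.
    In the clauses of the selected one that literal is false, so the other literal, if any, must
    hold. *)
Lemma sat_Cl phi :
  sat_cnf phi (Cl N) <->
  forall c, c \in ct3 N ->
    t2_consistent (disjunct_network N (sel_disjunct c (phi c))) /\
    forall c', c' \in ct3 N -> c' != c ->
      phi_hat N (sel_disjunct c (phi c)) (tpt (sel_disjunct c' (phi c')))
        <= hi (sel_disjunct c' (phi c')).
Proof.
have sat_clauses c : sat_cnf phi (clauses_of N c (phi c)) ->
    t2_consistent (disjunct_network N (sel_disjunct c (phi c))) /\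
    forall c', c' \in ct3 N -> c' != c ->
      phi_hat N (sel_disjunct c (phi c)) (tpt (sel_disjunct c' (phi c')))
        <= hi (sel_disjunct c' (phi c')).
  rewrite /clauses_of; case: ifPn => [/asboolP cons|_]; last first.
    by rewrite /sat_cnf /= orbF andbT; case: (phi c).
  move=> /allP H; split=> // c' c'N c'c; rewrite leNgt; apply/negP => hlt.
  (* An exceeded upper bound puts this clause into the formula, although [phi] falsifies both of its
     literals. *)
  have: has (fun l => phi l.1 == l.2) [:: (c, ~~ phi c); (c', ~~ phi c')].
    apply: H; apply/flattenP; eexists.
      by apply/mapP; exists c' => //; rewrite mem_filter c'c.
    rewrite mem_cat; case: (phi c') hlt => /= ->; rewrite mem_head ?orbT //.
  by rewrite /= orbF; case: (phi c); case: (phi c').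
split=> [/allP H c cN|H].
  apply: sat_clauses; apply/allP => cl clc; apply: H.
  apply/flattenP; eexists; first by apply/mapP; exists c.
  by rewrite mem_cat; case: (phi c) clc => ->; rewrite ?orbT.
suff Hb b c : c \in ct3 N -> sat_cnf phi (clauses_of N c b).
  apply/allP => cl /flattenP[_ /mapP[c cN ->]].
  by rewrite mem_cat => /orP[]; apply: (allP (Hb _ _ cN)).
move=> cN; have [cons Hc] := H c cN.
have [bE|bN] := eqVneq b (phi c); last first.
  have bE : phi c == ~~ b by case: b (phi c) bN => -[].
  rewrite /clauses_of; case: ifP => _; last by rewrite /sat_cnf /= bE.
  apply/allP => cl /flattenP[_ /mapP[c' _ ->]]; rewrite mem_cat => /orP[];
    by case: ifP => _ //; rewrite inE => /eqP -> /=; rewrite bE.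
rewrite /clauses_of bE asboolT //.
apply/allP => cl /flattenP[_ /mapP[c' + ->]].
rewrite mem_filter => /andP[c'c c'N]; have := Hc c' c'N c'c.
rewrite mem_cat => hle /orP[]; case: ifPn => // hlt; rewrite inE => /eqP -> /=;
  case: (phi c') hle => /=; rewrite ?orbT // leNgt hlt //.
Qed.

Lemma Cl_satisfiable (s : T -> R) :
  nonneg_schedule s -> feasible N s ->
  sat_cnf (fun c => sat_disjunct s c.1) (Cl N).
Proof.
move=> nns [fs /allP f3].
have selP c : c \in ct3 N ->
    sat_disjunct s (sel_disjunct c (sat_disjunct s c.1)).
  by move/f3; rewrite /sat_t3 /sel_disjunct; case: ifP.
apply/sat_Cl => c cN; have [cons le_s] := phi_hat_le nns fs (selP _ cN).
split=> // c' c'N _; apply: le_trans (le_s _) _.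
by have /andP[] := selP _ c'N.
Qed.

(** Without type-3 constraints [phi_check] is the least feasible schedule of [N], whose existence is
    certified by [s0]. *)
Lemma phi_check_feasible phi (s0 : T -> R) :
  (ct3 N = [::] -> nonneg_schedule s0 /\ t2_feasible N s0) ->
  sat_cnf phi (Cl N) -> feasible N (phi_check N phi).
Proof.
move=> H0 /sat_Cl Hphi; rewrite /feasible /phi_check.
case E : (ct3 N) => [|c0 cs].
  by have [nn0 f0] := H0 E; have [] := least_feasibleP nn0 f0.
set s := fun X : T => _.
pose f c := phi_hat N (sel_disjunct c (phi c)).
have sP X := bigmax_attained c0 cs (fun c => f c X).
rewrite -E in sP *; have fP c : c \in ct3 N -> _ := fun cN => phi_hatP (Hphi c cN).1.
split.
  by apply: (t2_feasible_max (r := ct3 N) (f := f)) => // c /fP[].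
apply/allP => c cN.
suff : sat_disjunct s (sel_disjunct c (phi c)).
  by rewrite /sat_t3; case: (phi c) => /= ->; rewrite ?orbT.
have [_ _ /andP[lo_c hi_c]] := fP c cN.
have [ub [c' c'N sE]] := sP (tpt (sel_disjunct c (phi c))).
apply/andP; split; first exact: le_trans lo_c (ub c cN).
(* The maximum at this time-point is attained by the schedule of [c']: if [c'] is [c], its own
   disjunct gives the bound, otherwise the clauses do. *)
rewrite /s sE; have [<-//|c'c] := eqVneq c c'.
exact: (Hphi c' c'N).2.
Qed.

End Clauses.

(* The hypothesis [origin_early] says that the time origin precedes the whole
   of some feasible schedule; it can be met by a translation of the unary
   bounds. *)
Theorem theorem7 (R : realType) (disp : Order.disp_t) (T : finOrderType disp)
    (solve : cnf (t3_constraint R T) -> option (t3_constraint R T -> bool))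
    (solveP : solves_2sat solve)
    (N : rdtn R T)
    (origin_early :
       consistent N -> exists s : T -> R, nonneg_schedule s /\ feasible N s) :
  (consistent N -> exists s : T -> R, RDTP solve N = Some s /\ feasible N s)
  /\ (~ consistent N -> RDTP solve N = None).
Proof.
have H := solveP _ (Cl_is_2cnf N).
rewrite /RDTP; split=> [consN|inconsN].
  have [s [nns fs]] := origin_early consN.
  rewrite asboolT; last by exists s; case: fs.
  case: (solve (Cl N)) H => [phi satphi|[]]; last first.
    by exists (fun c => sat_disjunct s c.1); apply: Cl_satisfiable.
  exists (phi_check N phi); split=> //.
  by apply: (phi_check_feasible (s0 := s)) => // _; case: fs.
case: asboolP => // -[s fs].
case: (solve (Cl N)) H => [phi satphi|//].
case: (inconsN); exists (phi_check N phi).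
(* Here [s] may take negative values, but the condition on it holds vacuously: with no type-3
   constraints, [s] would make [N] consistent. *)
apply: (phi_check_feasible (s0 := s)) => // E0.
by case: inconsN; exists s; split; rewrite ?E0.
Qed.
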